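(* Let $s\in\mathbb{N}$. For the static case, the tensor field $h_{\mu\nu}(\mathbf{x})=(\mathcal{E}_{(\ell)}\ast\Phi_{\mu\nu})(\mathbf{x})$, $\mathbf{x}\in\mathbb{R}^3$, is bounded by $$|h_{\mu\nu}(\mathbf{x})|\le C_{\mu\nu}\,(1+|\mathbf{x}|^s),$$ where $C_{\mu\nu}$ is a constant tensor.
   Context: Here $\ell>0$ and $\mathcal{E}_{(\ell)}(\mathbf{x})=\frac{1}{(2\ell\sqrt{\pi})^3}e^{-\frac{|\mathbf{x}|^2}{4\ell^2}}$ for $\mathbf{x}\in\mathbb{R}^3$. The indices $\mu,\nu$ run over $0,\dots,3$, and $\Phi_{\mu\nu}$ are regular tempered distributions, i.e. tempered distributions given by locally integrable functions $f$ of slow growth ($\int |f(\mathbf{x})|(1+|\mathbf{x}|^2)^{-r/2}\,d\mathbf{x}<\infty$ for a certain $r\ge 0$). ''Static'' means that the fields do not depend on time, so that $\Phi_{\mu\nu}$ and $h_{\mu\nu}$ are considered on $\mathbb{R}^3$. The convolution means $h_{\mu\nu}(\mathbf{x})=\left(\Phi_{\mu\nu}(\mathbf{x}^\prime),\mathcal{E}_{(\ell)}(\mathbf{x}-\mathbf{x}^\prime)\right)$, the value of the distribution $\Phi_{\mu\nu}$ on the Schwartz function $\mathbf{x}^\prime\mapsto\mathcal{E}_{(\ell)}(\mathbf{x}-\mathbf{x}^\prime)$.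
   Formalization: ''Let s∈ℕ'' is read as ''there is an s∈ℕ'' (depending on the fields Φ_{μν} and ℓ, the same for all μ,ν), since the bound fails for arbitrary s: for Φ_{μν}=|x|^5 and s=0 the field h_{μν} is unbounded. *)

(* Defs.v *)
From HB Require Import structures.
From mathcomp Require Import all_boot all_order all_algebra.
From mathcomp Require Import all_classical all_reals all_analysis.

Set Implicit Arguments.
Unset Strict Implicit.
Unset Printing Implicit Defensive.
Import Order.TTheory GRing.Theory Num.Theory.
Import numFieldNormedType.Exports.

Local Open Scope classical_set_scope.
Local Open Scope ring_scope.

(* A notation, so that the product topology and normed module structure of
   R * R * R are inferred.  The library norm of this product is the max norm;
   the Euclidean norm is [enorm]. *)
Notation space3 R := (R * R * R)%type.

Section Static.
Context {R : realType}.
Implicit Types (f phi psi : space3 R -> R) (T : (space3 R -> R) -> R).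

Definition enorm (x : space3 R) : R :=
  Num.sqrt (x.1.1 ^+ 2 + x.1.2 ^+ 2 + x.2 ^+ 2).

(* [measurableTypeR R] is [R] with the Borel sigma-algebra carried by
   [lebesgue_measure]. *)
Local Notation mR := (measurableTypeR R).
Definition leb3 : {measure set (mR * mR * mR)%type -> \bar R} :=
  ((@lebesgue_measure R \x @lebesgue_measure R) \x @lebesgue_measure R)%E.

Definition unit_vector (i : 'I_3) : space3 R :=
  ((i == 0 :> nat)%:R, (i == 1 :> nat)%:R, (i == 2 :> nat)%:R).

(* The iterated partial derivative along a word of directions; the words play
   the role of multi-indices. *)
Definition partial (w : seq 'I_3) f : space3 R -> R :=
  foldr (fun i g x => 'D_(unit_vector i) g x) f w.

Definition smooth f := forall (w : seq 'I_3) x, differentiable (partial w f) x.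

Definition schwartz_seminorm (k : nat) (w : seq 'I_3) f : \bar R :=
  ereal_sup (range (fun x => (enorm x ^+ k * `|partial w f x|)%:E)).

Definition schwartz f :=
  smooth f /\ forall k w, (schwartz_seminorm k w f < +oo)%E.

Definition cvg0_schwartz (phi : nat -> space3 R -> R) :=
  forall k w, schwartz_seminorm k w (phi n) @[n --> \oo] --> 0%E.

(* A distribution is encoded as a functional on all functions; only its values
   on Schwartz functions are constrained.  The Schwartz space is metrizable, so
   sequential continuity at 0 of a linear functional is continuity. *)
Definition tempered_distribution T :=
  (forall (a : R) phi psi, schwartz phi -> schwartz psi ->
     T (fun x => a * phi x + psi x) = a * T phi + T psi) /\
  (forall phi : nat -> space3 R -> R, (forall n, schwartz (phi n)) ->
     cvg0_schwartz phi -> T (phi n) @[n --> \oo] --> (0 : R)).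

Definition locally_integrable3 f :=
  measurable_fun [set: mR * mR * mR] (f : mR * mR * mR -> R) /\
  forall K : set (space3 R), compact K -> leb3.-integrable K (EFin \o f).

Definition slow_growth f := exists r : R, 0 <= r /\
  (\int[leb3]_x (`|f x| * (1 + enorm x ^+ 2) `^ (- (r / 2)))%:E < +oo)%E.

Definition regular_tempered_distribution T :=
  tempered_distribution T /\
  exists f, [/\ locally_integrable3 f, slow_growth f &
    forall phi, schwartz phi -> T phi = \int[leb3]_x (f x * phi x)].

Definition gauss_kernel (l : R) (x : space3 R) : R :=
  ((2 * l * Num.sqrt pi) ^+ 3)^-1 * expR (- (enorm x ^+ 2 / (4 * l ^+ 2))).

Definition gauss_conv (l : R) T (x : space3 R) : R :=
  T (fun x' => gauss_kernel l (x - x')).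

End Static.

(* Main.v *)
Require Import Defs.
From mathcomp Require Import all_boot all_order all_algebra.
From mathcomp Require Import all_classical all_reals all_analysis.
From mathcomp Require Import measurable_realfun ring lra.
Import Order.TTheory GRing.Theory Num.Theory.
Import numFieldNormedType.Exports.
Local Open Scope classical_set_scope.
Local Open Scope ring_scope.

(* With E = gauss_kernel l, every derivative of y |-> E (x - y) is a polynomial
   in y times that function.  Peetre's inequality
     1 + |y|^2 <= 2 (1 + |x|^2) (1 + |x - y|^2),
   together with the boundedness of E(z) (1 + |z|^2)^N, yields
     E (x - y) (1 + |y|^2)^N <= K (1 + |x|^2)^N.
   Hence y |-> E (x - y) is a Schwartz function, so that the convolution is the
   integral of f(y) E (x - y), and for N >= r / 2 this integral is at most
   K (1 + |x|^2)^N times the integral of |f(y)| (1 + |y|^2)^(- r / 2).  All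
   large N being allowed, one N serves the sixteen components. *)

(** Polynomials in the three coordinates, as an inductive predicate on functions: differentiability,
    stability under derivation, measurability and growth then all follow by induction. *)
Inductive polyfun {R : realType} : (space3 R -> R) -> Prop :=
| polyfun_cst (a : R) : polyfun (fun=> a)
| polyfun_x1 : polyfun (fun x => x.1.1)
| polyfun_x2 : polyfun (fun x => x.1.2)
| polyfun_x3 : polyfun (fun x => x.2)
| polyfunD p q : polyfun p -> polyfun q -> polyfun (fun x => p x + q x)
| polyfunM p q : polyfun p -> polyfun q -> polyfun (fun x => p x * q x).

(** * Calculus of polynomial functions on three-space *)

Section polyfun_theory.
Context {R : realType}.
Implicit Types (x y u : space3 R) (p q : space3 R -> R).
Local Notation mR := (measurableTypeR R).

Lemma continuous_x1 : continuous (fst \o fst : space3 R -> R).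
Proof.
by move=> y; apply: (@continuous_comp _ _ _ fst fst); exact: cvg_fst.
Qed.

Lemma continuous_x2 : continuous (snd \o fst : space3 R -> R).
Proof.
by move=> y; apply: (@continuous_comp _ _ _ fst snd);
  [exact: cvg_fst|exact: cvg_snd].
Qed.

Lemma polyfun_differentiable p x : polyfun p -> differentiable p x.
Proof.
elim=> [a||||p' q' _ dp _ dq|p' q' _ dp _ dq].
- exact: differentiable_cst.
- apply: (@linear_differentiable _ (R * R * R)%type R (fst \o fst)).
  exact: continuous_x1.
- apply: (@linear_differentiable _ (R * R * R)%type R (snd \o fst)).
  exact: continuous_x2.
- apply: (@linear_differentiable _ (R * R * R)%type R snd) => y /=.
  exact: cvg_snd.
- exact: differentiableD.
- exact: differentiableM.
Qed.

Lemma polyfun_derive p u : polyfun p -> polyfun (fun x => 'D_u p x).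
Proof.
elim=> [a||||p' q' Pp dp Pq dq|p' q' Pp dp Pq dq].
- under eq_fun do rewrite (derive_cst (V := (R * R * R)%type)).
  exact: polyfun_cst.
(* A coordinate is linear and continuous, hence its own differential, so its derivative along [u] is
   constant. *)
- rewrite [X in polyfun X](_ : _ = fun=> u.1.1); first exact: polyfun_cst.
  apply/funext => x; rewrite deriveE; last exact/polyfun_differentiable/polyfun_x1.
  by rewrite (@diff_lin _ (R * R * R)%type R (fst \o fst))//; exact: continuous_x1.
- rewrite [X in polyfun X](_ : _ = fun=> u.1.2); first exact: polyfun_cst.
  apply/funext => x; rewrite deriveE; last exact/polyfun_differentiable/polyfun_x2.
  by rewrite (@diff_lin _ (R * R * R)%type R (snd \o fst))//; exact: continuous_x2.
- rewrite [X in polyfun X](_ : _ = fun=> u.2); first exact: polyfun_cst.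
  apply/funext => x; rewrite deriveE; last exact/polyfun_differentiable/polyfun_x3.
  by rewrite (@diff_lin _ (R * R * R)%type R snd)// => y; exact: cvg_snd.
- rewrite [X in polyfun X](_ : _ = fun x => 'D_u p' x + 'D_u q' x).
    exact: polyfunD.
  by apply/funext => x; rewrite deriveD//; apply: diff_derivable;
    exact: polyfun_differentiable.
- rewrite [X in polyfun X](_ : _ = fun x => p' x * 'D_u q' x + q' x * 'D_u p' x).
    by apply: polyfunD; exact: polyfunM.
  by apply/funext => x; rewrite deriveM//; apply: diff_derivable;
    exact: polyfun_differentiable.
Qed.

Lemma polyfun_measurable p : polyfun p ->
  measurable_fun [set: mR * mR * mR] (p : mR * mR * mR -> R).
Proof.
elim=> [a||||p' q' _ mp _ mq|p' q' _ mp _ mq].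
- exact: measurable_cst.
- exact: (measurableT_comp measurable_fst measurable_fst).
- exact: (measurableT_comp measurable_snd measurable_fst).
- exact: measurable_snd.
- exact: measurable_funD.
- exact: measurable_funM.
Qed.

Lemma polyfun_expR_differentiable p q x : polyfun p -> polyfun q ->
  differentiable (fun y => p y * expR (q y)) x.
Proof.
move=> Pp Pq; apply: differentiableM; first exact: polyfun_differentiable.
apply: (differentiable_comp (polyfun_differentiable _ _ Pq)).
by apply/derivable1_diffP; exact: derivable_expR.
Qed.

(** Product and chain rules; the first factor on the right is again polynomial, so this class of
    functions is stable under derivation. *)
Lemma polyfun_expR_derive p q x u : polyfun p -> polyfun q ->
  'D_u (fun y => p y * expR (q y)) x =
  ('D_u p x + p x * 'D_u q x) * expR (q x).
Proof.
move=> Pp Pq; have dp := polyfun_differentiable _ x Pp.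
have dq := polyfun_differentiable _ x Pq.
have de : differentiable expR (q x).
  by apply/derivable1_diffP; exact: derivable_expR.
have dc : differentiable (expR \o q) x by exact: differentiable_comp.
rewrite (deriveM (f := p) (g := expR \o q)); try exact: diff_derivable.
rewrite [X in p x *: X](_ : _ = 'D_u q x * expR (q x)).
  by rewrite /GRing.scale/=; ring.
by rewrite (deriveE u dc) (deriveE u dq) (diff_comp dq de) [LHS]/= (diff1E de)
  derive1E derive_val.
Qed.

(** * Euclidean norm and polynomial growth *)

Lemma enorm_ge0 x : 0 <= enorm x.
Proof. exact: sqrtr_ge0. Qed.

Lemma sqr_enorm x : enorm x ^+ 2 = x.1.1 ^+ 2 + x.1.2 ^+ 2 + x.2 ^+ 2.
Proof. by rewrite sqr_sqrtr// !addr_ge0// sqr_ge0. Qed.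

(** Summing the coordinatewise bound gives [|y|^2 <= 2|x|^2 + 2|x - y|^2]; the product on the right
    only adds nonnegative terms. *)
Lemma peetre x y :
  1 + enorm y ^+ 2 <= 2 * (1 + enorm x ^+ 2) * (1 + enorm (x - y) ^+ 2).
Proof.
have split2 (a b : R) : b ^+ 2 <= 2 * a ^+ 2 + 2 * (a - b) ^+ 2.
  by rewrite -subr_ge0 [leRHS](_ : _ = (2 * a - b) ^+ 2) ?sqr_ge0//; ring.
have yxy : enorm y ^+ 2 <= 2 * enorm x ^+ 2 + 2 * enorm (x - y) ^+ 2.
  rewrite !sqr_enorm/=; have := split2 x.1.1 y.1.1.
  by have := split2 x.1.2 y.1.2; have := split2 x.2 y.2; lra.
have := mulr_ge0 (sqr_ge0 (enorm x)) (sqr_ge0 (enorm (x - y))); lra.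
Qed.

(** The base [1 + |x|^2] is at least 1, so its powers increase with the exponent, and [N + M] serves
    for sums as well as for products. *)
Lemma polyfun_growth p : polyfun p ->
  exists C N, 0 <= C /\ forall x, `|p x| <= C * (1 + enorm x ^+ 2) ^+ N.
Proof.
have one_le x : 1 <= 1 + enorm x ^+ 2 by rewrite lerDl sqr_ge0.
(* From [(1 - a)^2 >= 0] and [(1 + a)^2 >= 0]: [2|a| <= 1 + a^2]. *)
have coord (a s : R) : a ^+ 2 <= s -> `|a| <= 1 * (1 + s) ^+ 1.
  by move=> ?; rewrite mul1r expr1 ler_norml; have := sqr_ge0 (1 - a);
    have := sqr_ge0 (1 + a); have := sqr_ge0 a; move=> *; apply/andP; split; lra.
elim=> [a||||p' q' _ [C [N [C0 pC]]] _ [D [M [D0 qD]]]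
            |p' q' _ [C [N [C0 pC]]] _ [D [M [D0 qD]]]].
- by exists `|a|, 0; split=> // x; rewrite expr0 mulr1.
- exists 1, 1; split=> // x; apply: coord; rewrite sqr_enorm.
  have := sqr_ge0 x.1.1; have := sqr_ge0 x.1.2; have := sqr_ge0 x.2; lra.
- exists 1, 1; split=> // x; apply: coord; rewrite sqr_enorm.
  have := sqr_ge0 x.1.1; have := sqr_ge0 x.1.2; have := sqr_ge0 x.2; lra.
- exists 1, 1; split=> // x; apply: coord; rewrite sqr_enorm.
  have := sqr_ge0 x.1.1; have := sqr_ge0 x.1.2; have := sqr_ge0 x.2; lra.
- exists (C + D), (N + M)%N; split=> [|x]; first exact: addr_ge0.
  rewrite (le_trans (ler_normD _ _))// mulrDl lerD//.
  + by rewrite (le_trans (pC x))// ler_wpM2l// ler_weXn2l// leq_addr.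
  + by rewrite (le_trans (qD x))// ler_wpM2l// ler_weXn2l// leq_addl.
- exists (C * D), (N + M)%N; split=> [|x]; first exact: mulr_ge0.
  by rewrite normrM exprD mulrACA ler_pM.
Qed.

End polyfun_theory.

(** * The Gaussian kernel and its convolution *)

Section gauss_convolution.
Context {R : realType} (l : R) (l_gt0 : 0 < l).
Implicit Types x y : space3 R.
Local Notation mR := (measurableTypeR R).

Lemma gauss_kernel_ge0 x : 0 <= gauss_kernel l x.
Proof.
by rewrite mulr_ge0 ?expR_ge0// invr_ge0 exprn_ge0// !mulr_ge0 ?sqrtr_ge0// ltW.
Qed.

Lemma gauss_kernel_decay N :
  exists2 K, 0 <= K & forall x, gauss_kernel l x * (1 + enorm x ^+ 2) ^+ N <= K.
Proof.
pose c := ((2 * l * Num.sqrt pi) ^+ 3)^-1.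
have c0 : 0 <= c by rewrite invr_ge0 exprn_ge0// !mulr_ge0 ?sqrtr_ge0// ltW.
pose a := 4 * l ^+ 2; have a0 : 0 < a by rewrite mulr_gt0// exprn_gt0.
have fact0 : 0 < (N.+1)`!%:R :> R by rewrite ltr0n fact_gt0.
(* With [t = 1 + |x|^2], the exponential is [exp(1/a) exp(-t/a)]. A single term of the exponential
   series gives [t^(N+1) <= a^(N+1) (N+1)! exp(t/a)], and [t >= 1] allows passing from [t^N] to
   [t^(N+1)]. *)
exists (c * (a ^+ N.+1 * (N.+1)`!%:R * expR a^-1)).
  by rewrite mulr_ge0// !mulr_ge0 ?expR_ge0// exprn_ge0// ltW.
move=> x; rewrite /gauss_kernel -/c -/a -[leLHS]mulrA ler_wpM2l//.
set t := 1 + enorm x ^+ 2.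
have t1 : 1 <= t by rewrite lerDl sqr_ge0.
have t0 : 0 <= t by rewrite (le_trans _ t1).
have ta0 : 0 <= t / a by rewrite divr_ge0// ltW.
have -> : - (enorm x ^+ 2 / a) = a^-1 - t / a by rewrite /t; field; rewrite gt_eqF.
have tN : t ^+ N <= a ^+ N.+1 * (N.+1)`!%:R * expR (t / a).
  apply: (@le_trans _ _ (t ^+ N.+1)); first exact: ler_weXn2l.
  rewrite -mulrA -ler_pdivrMl ?exprn_gt0// -ler_pdivrMl//.
  have := expR_ge1Dxn N ta0; rewrite expr_div_n; lra.
rewrite expRD expRN -[leLHS]mulrA [leLHS]mulrC ler_wpM2r ?expR_ge0//.
by rewrite [leLHS]mulrC ler_pdivrMr ?expR_gt0.
Qed.

Lemma gauss_kernel_translate_decay N :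
  exists2 K, 0 <= K & forall x y, gauss_kernel l (x - y) *
    (1 + enorm y ^+ 2) ^+ N <= K * (1 + enorm x ^+ 2) ^+ N.
Proof.
have [K K0 Kdecay] := gauss_kernel_decay N.
exists (2 ^+ N * K) => [|x y]; first by rewrite mulr_ge0// exprn_ge0.
have one_le z : 0 <= 1 + enorm z ^+ 2 :> R by rewrite addr_ge0// sqr_ge0.
apply: (@le_trans _ _ (gauss_kernel l (x - y) *
    (2 * (1 + enorm x ^+ 2) * (1 + enorm (x - y) ^+ 2)) ^+ N)).
  rewrite ler_wpM2l ?gauss_kernel_ge0// lerXn2r ?nnegrE ?one_le ?mulr_ge0//.
  exact: peetre.
rewrite !exprMn [leLHS](_ : _ = 2 ^+ N * (1 + enorm x ^+ 2) ^+ N *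
  (gauss_kernel l (x - y) * (1 + enorm (x - y) ^+ 2) ^+ N)); last by ring.
rewrite [leRHS](_ : _ = 2 ^+ N * (1 + enorm x ^+ 2) ^+ N * K); last by ring.
by rewrite ler_wpM2l// mulr_ge0// exprn_ge0.
Qed.

(** Brings the translated kernel into the form covered by the derivation rule above; [c > 0] allows
    dividing by [c] later. *)
Lemma gauss_kernel_polyfun x : exists2 c, 0 < c & exists2 q, polyfun q &
  forall y, gauss_kernel l (x - y) = c * expR (q y).
Proof.
pose c := ((2 * l * Num.sqrt pi) ^+ 3)^-1.
pose b := - (4 * l ^+ 2)^-1.
(* Differences are written with [-1 *], as [polyfun] is built from sums and products only. *)
have sub (f : space3 R -> R) (a : R) : polyfun f ->
    polyfun (fun y => (a + -1 * f y) * (a + -1 * f y)).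
  move=> Pf; have Paf : polyfun (fun y => a + -1 * f y).
    by apply: polyfunD; [|apply: polyfunM => //]; exact: polyfun_cst.
  exact: polyfunM.
exists c.
  by rewrite invr_gt0 exprn_gt0// !mulr_gt0// sqrtr_gt0 pi_gt0.
exists (fun y => b *
  ((x.1.1 + -1 * y.1.1) * (x.1.1 + -1 * y.1.1) +
   (x.1.2 + -1 * y.1.2) * (x.1.2 + -1 * y.1.2) +
   (x.2 + -1 * y.2) * (x.2 + -1 * y.2))).
  apply: polyfunM; first exact: polyfun_cst.
  apply: polyfunD; [apply: polyfunD|]; apply: sub.
  - exact: polyfun_x1.
  - exact: polyfun_x2.
  - exact: polyfun_x3.
move=> y; rewrite /gauss_kernel -/c; congr (_ * expR _).
by rewrite mulrC -mulNr -/b sqr_enorm/= !mulN1r !expr2.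
Qed.

Lemma partial_gauss_kernel w x : exists2 p, polyfun p &
  partial w (fun y => gauss_kernel l (x - y)) =
  (fun y => p y * gauss_kernel l (x - y)).
Proof.
have [c c0 [q Pq gE]] := gauss_kernel_polyfun x.
have gpE p : (fun y => p y * gauss_kernel l (x - y)) =
             (fun y => (c * p y) * expR (q y)).
  by apply/funext => y; rewrite gE mulrCA mulrA.
elim: w => [|i w [p Pp IH]].
  exists (fun=> 1); first exact: polyfun_cst.
  by apply/funext => y; rewrite mul1r.
have Pcp : polyfun (fun y => c * p y) by apply: polyfunM => //; exact: polyfun_cst.
pose u : space3 R := unit_vector i.
(* The derivation rule is applied to [(c * p) * expR q]; [c^-1] undoes the [c] absorbed when the
   kernel is rewritten as [c * expR q]. *)
exists (fun y => c^-1 * ('D_u (fun y => c * p y) y + (c * p y) * 'D_u q y)).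
  apply: polyfunM; first exact: polyfun_cst.
  apply: polyfunD; first exact: polyfun_derive.
  by apply: polyfunM => //; exact: polyfun_derive.
rewrite gpE /= IH gpE; apply/funext => y.
by rewrite polyfun_expR_derive// mulVKf ?gt_eqF.
Qed.

Lemma gauss_kernel_schwartz x : schwartz (fun y => gauss_kernel l (x - y)).
Proof.
split=> [w y|k w].
  have [c c0 [q Pq gE]] := gauss_kernel_polyfun x.
  have [p Pp ->] := partial_gauss_kernel w x.
  rewrite (_ : (fun y => _) = (fun y => (c * p y) * expR (q y))).
    apply: polyfun_expR_differentiable => //.
    by apply: polyfunM => //; exact: polyfun_cst.
  by apply/funext => z; rewrite gE mulrCA mulrA.
have [p Pp pE] := partial_gauss_kernel w x.
have [C [N [C0 pC]]] := polyfun_growth _ Pp.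
(* Order [k] absorbs the weight [|y|^k] and order [N] the polynomial factor; [x] is fixed, so the
   resulting bound is constant in [y]. *)
have [K K0 decay] := gauss_kernel_translate_decay (k + N).
rewrite /schwartz_seminorm.
apply: (@le_lt_trans _ _ (C * (K * (1 + enorm x ^+ 2) ^+ (k + N)))%:E); last exact: ltry.
apply: ge_ereal_sup => _ [y _ <-]; rewrite lee_fin pE.
apply: le_trans (ler_wpM2l C0 (decay x y)).
have t1 : 1 <= 1 + enorm y ^+ 2 by rewrite lerDl sqr_ge0.
have ek : enorm y ^+ k <= (1 + enorm y ^+ 2) ^+ k.
  rewrite lerXn2r ?nnegrE ?enorm_ge0// ?addr_ge0 ?sqr_ge0//.
  by have := sqr_ge0 (1 - enorm y); have := sqr_ge0 (enorm y); lra.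
rewrite normrM (ger0_norm (gauss_kernel_ge0 _)) exprD.
rewrite [leRHS](_ : _ = (1 + enorm y ^+ 2) ^+ k *
  ((C * (1 + enorm y ^+ 2) ^+ N) * gauss_kernel l (x - y))); last by ring.
apply: ler_pM => //; first by rewrite exprn_ge0// enorm_ge0.
  by apply: mulr_ge0 => //; exact: gauss_kernel_ge0.
by rewrite ler_wpM2r ?gauss_kernel_ge0.
Qed.


(** The exponent is even because the bound comes as a power of [1 + |x|^2]. *)
Lemma gauss_conv_growth (T : (space3 R -> R) -> R) :
  regular_tempered_distribution T ->
  exists N0, forall N, (N0 <= N)%N ->
    exists C, forall x, `|gauss_conv l T x| <= C * (1 + enorm x ^+ (N + N)).
Proof.
case=> _ [f [[mf _] [r [r0 fr]] Tf]].
have t1 x : 1 <= 1 + enorm x ^+ 2 by rewrite lerDl sqr_ge0.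
have t0 x : 0 <= 1 + enorm x ^+ 2 by apply: le_trans (t1 x).
have [N0 rN0] : exists N0 : nat, r / 2 <= N0%:R.
  by exists (Num.truncn (r / 2)).+1; rewrite ltW// truncnS_gt.
exists N0 => N N0N.
have rN : r / 2 <= N%:R by rewrite (le_trans rN0)// ler_nat.
have [K K0 decay] := gauss_kernel_translate_decay N.
pose w (x : mR * mR * mR) : R := `|f x| * (1 + enorm x ^+ 2) `^ (- (r / 2)).
have w0 x : 0 <= w x by rewrite mulr_ge0// powR_ge0.
have mw : measurable_fun [set: mR * mR * mR] w.
  apply: measurable_funM; first exact: measurableT_comp.
  apply: (measurableT_comp (f := fun t : R => t `^ (- (r / 2)))
    (g := fun x : mR * mR * mR => 1 + enorm x ^+ 2)).
    exact: measurable_powR.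
  rewrite [X in measurable_fun _ X](_ : _ = fun x : space3 R => 1 +
    (x.1.1 * x.1.1 + x.1.2 * x.1.2 + x.2 * x.2)).
    apply: polyfun_measurable; apply: polyfunD; first exact: polyfun_cst.
    by apply: polyfunD; [apply: polyfunD|]; apply: polyfunM; constructor.
  by apply/funext => x; rewrite sqr_enorm !expr2.
pose I := fine (\int[leb3]_x (w x)%:E)%E.
have Ifin : (\int[leb3]_x (w x)%:E)%E \is a fin_num.
  by rewrite ge0_fin_numE// integral_ge0// => x _; rewrite lee_fin.
have I0 : 0 <= I by rewrite fine_ge0// integral_ge0// => x _; rewrite lee_fin.
(* [K] comes from the kernel decay, [I] from slow growth, and [2 ^+ N] from replacing
   [(1 + |x|^2)^N] by [1 + |x|^(2N)]. *)
exists (K * 2 ^+ N * I) => x.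
have sx := gauss_kernel_schwartz x.
rewrite /gauss_conv (Tf _ sx).
have mg : measurable_fun [set: mR * mR * mR]
    (fun y => f y * gauss_kernel l (x - y)).
  apply: measurable_funM => //.
  have [c c0 [q Pq gE]] := gauss_kernel_polyfun x.
  rewrite [X in measurable_fun _ X](_ : _ = fun y => c * expR (q y)).
    apply: measurable_funM => //.
    by apply: measurableT_comp => //; exact: polyfun_measurable.
  by apply/funext => y; rewrite gE.
(* After clearing the weight, the real power [r / 2] of [1 + |y|^2 >= 1] is at most the natural
   power [N], to which the kernel decay applies. *)
have gw y : `|f y * gauss_kernel l (x - y)| <= K * (1 + enorm x ^+ 2) ^+ N * w y.
  rewrite normrM (ger0_norm (gauss_kernel_ge0 _)) /w [leRHS]mulrCA ler_wpM2l//.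
  rewrite powRN ler_pdivlMr ?powR_gt0 ?(lt_le_trans _ (t1 y))//.
  apply: le_trans (decay x y); rewrite ler_wpM2l ?gauss_kernel_ge0//.
  by rewrite -(powR_mulrn N (t0 y)) ler_powR.
have le_int : (`|\int[leb3]_y (f y * gauss_kernel l (x - y))%:E| <=
    (K * (1 + enorm x ^+ 2) ^+ N * I)%:E)%E.
  apply: le_trans (le_abse_integral _ _ _) _ => //; first exact/measurable_EFinP.
  rewrite EFinM fineK// -ge0_integralZl//; last first.
  - by rewrite lee_fin mulr_ge0// exprn_ge0.
  - by move=> y _; rewrite lee_fin.
  - exact/measurable_EFinP.
  apply: ge0_le_integral => //.
  - by apply/measurable_EFinP; exact: measurableT_comp.
  - apply/measurable_EFinP; exact: measurable_funM.
  - by move=> y _; rewrite -EFinM lee_fin.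
apply: (@le_trans _ _ (K * (1 + enorm x ^+ 2) ^+ N * I)).
  rewrite -lee_fin /Rintegral; apply: le_trans le_int.
  (* The real integral is [fine] of the extended one: in the finite case the two absolute values
     agree, otherwise the right-hand side is infinite. *)
  have [/fineK <-//|] := boolP
    ((\int[leb3]_y (f y * gauss_kernel l (x - y))%:E)%E \is a fin_num).
  by rewrite fin_numEn => /orP[|] /eqP ->; rewrite leey.
(* With [t = |x|^2], [1 + t] is at most 2 if [t <= 1] and at most [2 t] otherwise. *)
have pow2 : (1 + enorm x ^+ 2) ^+ N <= 2 ^+ N * (1 + enorm x ^+ (N + N)).
  have -> : enorm x ^+ (N + N) = (enorm x ^+ 2) ^+ N by rewrite -exprM mul2n addnn.
  set t := enorm x ^+ 2; have t_ge0 : 0 <= t by exact: sqr_ge0.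
  have [tle1|/ltW tge1] := leP t 1.
    apply: (@le_trans _ _ (2 ^+ N)).
      by rewrite lerXn2r ?nnegrE//; lra.
    by rewrite ler_peMr ?exprn_ge0// lerDl exprn_ge0.
  apply: (@le_trans _ _ ((2 * t) ^+ N)).
    by rewrite lerXn2r ?nnegrE//; lra.
  by rewrite exprMn ler_wpM2l ?exprn_ge0// lerDr.
rewrite [leRHS](_ : _ = K * (2 ^+ N * (1 + enorm x ^+ (N + N))) * I); last by ring.
by rewrite ler_wpM2r// ler_wpM2l.
Qed.

End gauss_convolution.

Theorem proposition3p3 (R : realType) (l : R) (l_gt0 : 0 < l)
    (Phi : 'I_4 -> 'I_4 -> (space3 R -> R) -> R)
    (regPhi : forall mu nu, regular_tempered_distribution (Phi mu nu)) :
  exists (s : nat) (C : 'I_4 -> 'I_4 -> R),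
    forall (mu nu : 'I_4) (x : space3 R),
      `|gauss_conv l (Phi mu nu) x| <= C mu nu * (1 + enorm x ^+ s).
Proof.
have growth mu nu := gauss_conv_growth l l_gt0 _ (regPhi mu nu).
(* Thresholds are chosen over index pairs; their maximum is admissible for every component, and the
   constants are then chosen for this common exponent. *)
have /choice[n nP] (ij : 'I_4 * 'I_4) := growth ij.1 ij.2.
pose N := (\max_ij n ij)%N.
have /choice[C CP] (ij : 'I_4 * 'I_4) := nP ij N (leq_bigmax ij).
by exists (N + N)%N, (fun mu nu => C (mu, nu)) => mu nu; exact: CP (mu, nu).
Qed.
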